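(* Let $E$ be a normed vector space over $\mathbb K$ ($\mathbb R$ or $\mathbb C$) and $\mathbf y\in E'$ a continuous linear functional on $E$. Consider sequences $(\mathbf S_n)$ in $E$ of the form $$\mathbf S_n-\mathbf S\sim\sum_{i=1}^\infty a_i(n+b)^{-i}\mathbf u_i\quad(n\to\infty),$$ where $a_i,b\in\mathbb K$ and $\mathbf u_i\in E$. Let $\boldsymbol{\widehat\varepsilon}_{2k}^{(n)}$ be the first topological Shanks transforms of $(\mathbf S_n)$ with respect to $\mathbf y$. Then, when $k$ is fixed and $n$ tends to infinity, $$\boldsymbol{\widehat\varepsilon}_{2k}^{(n)}-\mathbf S\sim\frac{a_1\mathbf u_1}{(k+1)(n+b)}.$$
   Context: First topological Shanks transforms: with $\Delta\mathbf S_n=\mathbf S_{n+1}-\mathbf S_n$, for $k,n\ge 0$ let $a_0^{(n,k)},\ldots,a_k^{(n,k)}\in\mathbb K$ be the solution of $\sum_{i=0}^k a_i^{(n,k)}=1$ and $\sum_{i=0}^k a_i^{(n,k)}\langle\mathbf y,\Delta\mathbf S_{n+j+i}\rangle=0$ for $j=0,\ldots,k-1$. Then $\boldsymbol{\widehat\varepsilon}_{2k}^{(n)}=a_0^{(n,k)}\mathbf S_n+\cdots+a_k^{(n,k)}\mathbf S_{n+k}$. (The coefficients $a_i^{(n,k)}$ are unrelated to the $a_i$ of the expansion.) The symbol $\sim$ followed by an infinite series denotes an asymptotic expansion as $n\to\infty$: for each $p\ge1$, the difference between the left-hand side and the sum of the first $p$ terms is $o(n^{-p})$ in norm. The symbol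 $\sim$ followed by a single term means that this term is the leading term: the difference of the two sides is $o$ of the displayed scalar order, here $o(n^{-1})$. All quantities involved are assumed to be defined (the linear systems are uniquely solvable, at least for $n$ large).
   Formalization: As stated the claim fails, e.g. S_n=(1/n,1/n²), y the second coordinate, k=1. The formal theorem also assumes that y does not annihilate a_1u_1 when a_1u_1≠0, and that y(a_m u_m)≠0 for some m≥1. *)

(* Defs.v *)
From HB Require Import structures.
From mathcomp Require Import all_boot all_order all_algebra.
From mathcomp Require Import all_classical all_reals all_analysis.
From mathcomp Require Import complex.

Set Implicit Arguments.
Unset Strict Implicit.
Unset Printing Implicit Defensive.

Import Order.TTheory GRing.Theory Num.Theory.
Import numFieldNormedType.Exports.

Local Open Scope classical_set_scope.
Local Open Scope ring_scope.

Variant real_or_complex : numFieldType -> Prop :=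
| IsReal (R : realType) : real_or_complex R
| IsComplex (R : realType) : real_or_complex R[i].

Section AsymptoticExpansion.
Context {K : numFieldType} {E : normedModType K}.

(* [t i n] is the i-th term of the series, i = 1, 2, ...; [t 0] is unused. *)
Definition asymptotic_expansion (f : nat -> E) (t : nat -> nat -> E) : Prop :=
  forall p : nat, (0 < p)%N ->
    (fun n => f n - \sum_(1 <= i < p.+1) t i n)
      =o_\oo (fun n => n%:R ^- p : K^o).

End AsymptoticExpansion.

Section TopologicalShanks.
Context {K : numFieldType} {E : normedModType K}.
Variables (y : E -> K) (S : nat -> E) (k n : nat).

Definition fdiff (m : nat) : E := S m.+1 - S m.

Definition is_shanks_coefs (c : 'rV[K]_k.+1) : Prop :=
  \sum_(i < k.+1) c 0 i = 1 /\
  forall j : nat, (j < k)%N ->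
    \sum_(i < k.+1) c 0 i * y (fdiff (n + j + i)) = 0.

(* A solution of the linear system, and the junk value 0 if there is none. *)
Definition shanks_coefs : 'rV[K]_k.+1 :=
  xget 0 [set c | is_shanks_coefs c].

(* This is the transform with lower index 2k and upper index n. *)
Definition topological_shanks1 : E :=
  \sum_(i < k.+1) shanks_coefs 0 i *: S (n + i)%N.

End TopologicalShanks.

(* Main.v *)
(* Write D for the forward difference, F n = S n - Slim, s = y o F, and let m be
   the least index with y (a_m u_m) <> 0. By Newton's formula the transform
   minus Slim is sum_r d_r D^r F(n), with d_0 = 1 and
   sum_r d_r D^(r+j+1) s(n) = 0 for j < k. Since n^(m+q) D^q s(n) tends to
   (-1)^q m (m+1) ... (m+q-1) y (a_m u_m), the rescaled coefficients
   w_r = (-1)^r d_r / n^r satisfy in the limit sum_r w_r (m+r+j)! = 0 for j < k.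
   As (m+r+j)! is (m+r)! times a polynomial of degree j in r, this means
   sum_r w_r (m+r)! q(r) = 0 for every polynomial q of degree < k (so w is
   essentially a Laguerre polynomial). Lagrange polynomials q show that w stays
   bounded, whence n (transform - Slim) is equivalent to
   (sum_r w_r r!) a_1 u_1. If a_1 u_1 <> 0 then m = 1, and taking for q the
   interpolant of 1/(r+1) at r = 1, ..., k gives sum_r w_r r! -> 1/(k+1). *)

Require Import Defs.
From HB Require Import structures.
From mathcomp Require Import all_boot all_order all_algebra.
From mathcomp Require Import all_classical all_reals all_analysis.
From mathcomp Require Import complex.
From mathcomp Require Import ring zify.

Set Implicit Arguments.
Unset Strict Implicit.
Unset Printing Implicit Defensive.

Import Order.TTheory GRing.Theory Num.Theory.
Import numFieldNormedType.Exports.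

Local Open Scope classical_set_scope.
Local Open Scope ring_scope.

(** Both fields are Archimedean: a nonnegative complex number is real, hence bounded through its
    real part. Only here does the nature of [K] enter. *)
Lemma real_or_complex_cvg_invn (K : numFieldType) : real_or_complex K ->
  n%:R^-1 @[n --> \oo] --> (0 : K).
Proof.
move=> hK.
have arch (x : K) : 0 <= x -> exists n : nat, x < n%:R.
  case: K / hK x => R x x0.
    by exists (Num.bound x); exact: archi_boundP.
  exists (Num.bound (complex.Re x)).
  move: x0; rewrite lecE ltcE => /andP[/eqP /= imx rex].
  have -> : (Num.bound (complex.Re x))%:R =
      ((Num.bound (complex.Re x))%:R)%:C%C :> R[i] by rewrite rmorph_nat.
  by rewrite /= imx eqxx archi_boundP.
apply/cvgr0Pnorm_lt => e e0.
have [N hN] : exists n : nat, e^-1 < n%:R by apply: arch; rewrite invr_ge0 ltW.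
near=> n.
have nN : e^-1 < n%:R.
  by apply: lt_le_trans hN _; rewrite ler_nat; near: n; exact: nbhs_infty_ge.
have n0 : (0 : K) < n%:R by apply: lt_trans nN; rewrite invr_gt0.
by rewrite ger0_norm ?invr_ge0 ?ltW// invf_plt ?posrE.
Unshelve. all: by end_near. Qed.

(** * Algebra of iterated forward differences *)

Lemma iter_fdiff_eq (K : numFieldType) (E : normedModType K) (f g : nat -> E)
    (r n : nat) :
  (forall m, (n <= m)%N -> f m = g m) -> iter r fdiff f n = iter r fdiff g n.
Proof.
elim: r n => [|r IH] n fg /=; first exact: fg.
rewrite /fdiff (IH n)// (IH n.+1)// => m nm; exact/fg/ltnW.
Qed.

Lemma iter_fdiffD (K : numFieldType) (E : normedModType K) (f g : nat -> E)
    (r n : nat) :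
  iter r fdiff (fun m => f m + g m) n = iter r fdiff f n + iter r fdiff g n.
Proof.
elim: r n => [//|r IH] n /=.
by rewrite /fdiff !IH opprD addrACA.
Qed.

Lemma iter_fdiffZ (K : numFieldType) (E : normedModType K) (c : K)
    (f : nat -> E) (r n : nat) :
  iter r fdiff (fun m => c *: f m) n = c *: iter r fdiff f n.
Proof. by elim: r n => [//|r IH] n /=; rewrite /fdiff !IH scalerBr. Qed.

Lemma iter_fdiffZr (K : numFieldType) (E : normedModType K) (v : E)
    (f : nat -> K^o) (r n : nat) :
  iter r fdiff (fun m => f m *: v) n = iter r fdiff f n *: v.
Proof. by elim: r n => [//|r IH] n /=; rewrite /fdiff !IH scalerBl. Qed.

Lemma iter_fdiff0 (K : numFieldType) (E : normedModType K) (r n : nat) :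
  iter r fdiff (fun=> 0 : E) n = 0.
Proof. by elim: r n => [//|r IH] n /=; rewrite /fdiff !IH subrr. Qed.

Lemma iter_fdiff_sum (K : numFieldType) (E : normedModType K) (I : Type)
    (s : seq I) (P : pred I) (F : I -> nat -> E) (r n : nat) :
  iter r fdiff (fun m => \sum_(i <- s | P i) F i m) n
    = \sum_(i <- s | P i) iter r fdiff (F i) n.
Proof.
elim: s => [|i s IH].
  rewrite big_nil -[RHS](@iter_fdiff0 K E r n).
  by apply: iter_fdiff_eq => m _; rewrite big_nil.
rewrite big_cons -IH; case: ifPn => Pi; rewrite -?iter_fdiffD;
  by apply: iter_fdiff_eq => m _; rewrite big_cons; move: Pi; case: (P i).
Qed.

(** Induction on [i] by Pascal's rule. Any [N > i] will do, since the further binomials vanish. *)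
Lemma newton_forward (K : numFieldType) (E : normedModType K) (f : nat -> E)
    (N n i : nat) : (i < N)%N ->
  f (n + i)%N = \sum_(r < N) 'C(i, r)%:R *: iter r fdiff f n.
Proof.
elim: i N f => [|i IH] [//|N] f iN.
  by rewrite addn0 big_ord_recl big1 ?scale1r ?addr0// => r _; rewrite scale0r.
have -> : f (n + i.+1)%N = f (n + i)%N + fdiff f (n + i)%N.
  by rewrite /fdiff addnS addrC subrK.
rewrite (IH N.+1) ?(ltnW iN)// (IH N)// [LHS]addrC big_ord_recl.
rewrite [in RHS]big_ord_recl !bin0 addrCA; congr (_ + _).
rewrite -big_split/=; apply: eq_bigr => r _.
by rewrite -iterSr binS natrD scalerDl addrC.
Qed.

(** Leibniz rule: second differences of [m + b] vanish, and the shift in the first-order term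
    produces the extra [r%:R]. At [r = 0] the value [r.-1] is harmless, being multiplied by 0. *)
Lemma iter_fdiff_mulX (K : numFieldType) (b : K) (f : nat -> K^o)
    (r n : nat) :
  iter r fdiff (fun m => (m%:R + b) * f m : K^o) n
    = (n%:R + b + r%:R) * iter r fdiff f n + r%:R * iter r.-1 fdiff f n.
Proof.
elim: r n => [|r IH] n /=; first by rewrite mul0r !addr0.
rewrite /fdiff !IH; case: r {IH} => [|r] /=; rewrite /fdiff; ring.
Qed.

(** * Limits along the integers and little-o *)

Lemma near_eq_cvg_to (T : Type) (U : topologicalType) (F : set_system T)
    (FF : Filter F) (f g : T -> U) (l : U) :
  {near F, f =1 g} -> f x @[x --> F] --> l -> g x @[x --> F] --> l.
Proof. by move=> fg; apply: cvg_trans; exact: near_eq_cvg. Qed.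

Lemma cvgZ_bounded0 (K : numFieldType) (E : normedModType K) (T : Type)
    (F : set_system T) (FF : Filter F) (w : T -> K) (f : T -> E) (C : K) :
  (\forall n \near F, `|w n| <= C) -> f n @[n --> F] --> 0 ->
  w n *: f n @[n --> F] --> 0.
Proof.
move=> wC f0; apply/cvgr0Pnorm_le => e e0.
have C0 : 0 < `|C| + 1 by rewrite ltr_wpDl.
near=> n; rewrite normrZ.
have wn : `|w n| <= `|C| + 1.
  have wn : `|w n| <= C by near: n.
  apply: (le_trans wn); rewrite ger0_norm ?lerDl//.
  exact: le_trans wn.
apply: (@le_trans _ _ ((`|C| + 1) * (e / (`|C| + 1)))).
  apply: ler_pM => //; near: n.
  by apply: cvgr0_norm_le => //; rewrite divr_gt0.
by rewrite mulrCA divff ?mulr1// gt_eqF.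
Unshelve. all: by end_near. Qed.

Lemma littleo_invnP (K : numFieldType) (E : normedModType K) (p : nat)
    (f : nat -> E) :
  f =o_\oo (fun n => n%:R ^- p : K^o) <-> n%:R ^+ p *: f n @[n --> \oo] --> 0.
Proof.
rewrite eqoP; split=> [fo|f0].
  apply/cvgr0Pnorm_le => e e0; near=> n.
  have n0 : (0 < n)%N by near: n; exact: nbhs_infty_gt.
  have : `|f n| <= e * `|n%:R ^- p : K^o| by near: n; exact: fo.
  rewrite normrZ normfV -ler_pdivlMl ?normr_gt0 ?expf_neq0 ?pnatr_eq0 -?lt0n//.
  by rewrite mulrC.
move=> e e0; near=> n.
have n0 : (0 < n)%N by near: n; exact: nbhs_infty_gt.
have : `|n%:R ^+ p *: f n| <= e by near: n; exact: cvgr0_norm_le.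
rewrite normfV normrZ -ler_pdivlMl ?normr_gt0 ?expf_neq0 ?pnatr_eq0 -?lt0n//.
by rewrite mulrC.
Unshelve. all: by end_near. Qed.

(** If n + b = 0 then 1/n has norm 1/|b|, against its eventual bound 1/(|b| + 1). The form uniform
    in [m] suits differences at [n], which involve later indices. *)
Lemma near_infty_neq0 (K : numFieldType)
    (hK : n%:R^-1 @[n --> \oo] --> (0 : K)) (b : K) :
  \forall n \near \oo, forall m, (n <= m)%N -> m%:R + b != 0.
Proof.
have : \forall n \near \oo, n%:R + b != 0.
  have b0 : 0 < `|b| + 1 by rewrite ltr_wpDl.
  near=> n; apply/eqP => nb.
  have n0 : (0 < n)%N by near: n; exact: nbhs_infty_gt.
  have : `|n%:R^-1 : K| < (`|b| + 1)^-1.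
    by near: n; apply: cvgr0_norm_lt => //; rewrite invr_gt0.
  have -> : n%:R = - b by apply/eqP; rewrite -addr_eq0 nb.
  have b1 : 0 < `|b|.
    by rewrite -normrN -(addr0_eq nb) opprK normr_gt0 pnatr_eq0 -lt0n.
  by rewrite normfV normrN ltf_pV2 ?posrE// gtrDl ltr10.
case=> N _ hN; exists N => //= n Nn m nm; apply: hN.
exact: leq_trans nm.
Unshelve. all: by end_near. Qed.

Lemma cvg_ratio_shift (K : numFieldType)
    (hK : n%:R^-1 @[n --> \oo] --> (0 : K)) (c : K) :
  n%:R / (n%:R + c) @[n --> \oo] --> (1 : K).
Proof.
have h : (1 + c * n%:R^-1)^-1 @[n --> \oo] --> (1 : K).
  rewrite -[X in _ --> X]invr1; apply: cvgV; first exact: oner_neq0.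
  rewrite -[X in _ --> X]addr0; apply: cvgD; first exact: cvg_cst.
  by rewrite -(mulr0 c); apply: cvgM => //; exact: cvg_cst.
apply: near_eq_cvg_to h; near=> n.
have n0 : n%:R != 0 :> K.
  by rewrite pnatr_eq0 -lt0n; near: n; exact: nbhs_infty_gt.
by rewrite -{1}(divff n0) -mulrDl invf_div.
Unshelve. all: by end_near. Qed.

(** * Differences of an asymptotic expansion *)

(** The shifted term keeps its order because n/(n+1) is at most 1; no power of n is gained. *)
Lemma cvg0_scale_iter_fdiff (K : numFieldType) (E : normedModType K) (p r : nat)
    (f : nat -> E) :
  n%:R ^+ p *: f n @[n --> \oo] --> 0 ->
  n%:R ^+ p *: iter r fdiff f n @[n --> \oo] --> 0.
Proof.
move=> f0; elim: r => [//|r]; set h := iter r _ _ => h0.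
rewrite -[X in _ --> X]subr0 /=.
under eq_fun do rewrite /fdiff -/h scalerBr.
apply: cvgB => //.
move: (h0); rewrite -cvg_shiftS => hS.
have hE n : n%:R ^+ p *: h n.+1 =
    (n%:R / n.+1%:R) ^+ p *: (n.+1%:R ^+ p *: h n.+1).
  by rewrite scalerA -exprMn divfK ?pnatr_eq0.
under eq_fun do rewrite hE.
apply: (@cvgZ_bounded0 K E nat \oo _ _ _ 1) => //; near=> n.
rewrite ger0_norm ?exprn_ge0 ?divr_ge0//.
by rewrite exprn_ile1 ?divr_ge0// ler_pdivrMr ?ltr0n// mul1r ler_nat.
Unshelve. all: by end_near. Qed.

(** Induction on [i], then on [r]: the product rule reduces the pair [(i.+1, r.+1)] to [(i, r.+1)]
    and [(i.+1, r)]. *)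
Lemma cvg_scale_iter_fdiff_pow (K : numFieldType)
    (hK : n%:R^-1 @[n --> \oo] --> (0 : K)) (b : K) (i r : nat) :
  n%:R ^+ (i + r) * iter r fdiff (fun m => (m%:R + b) ^- i : K^o) n
    @[n --> \oo] --> ((-1) ^+ r * \prod_(s < r) (i + s)%:R : K).
Proof.
elim: i r => [r|i IHi r].
  case: r => [|r].
    under eq_fun do rewrite /= !expr0 invr1 mulr1.
    by rewrite expr0 big_ord0 mulr1; exact: cvg_cst.
  (* For [i = 0] the factor [s = 0] kills the limit, as befits differences of a constant. *)
  rewrite big_ord_recl mul0r mulr0.
  apply: cvg_near_cst; near=> n.
  rewrite iterSr (@iter_fdiff_eq K K^o _ (fun=> 0)) ?iter_fdiff0 ?mulr0//.
  move=> m _.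
  by rewrite /fdiff !expr0 subrr.
(* Leibniz rule for the r'-th difference of (m + b) * (m + b) ^- i.+1. *)
have rec r' : \forall n \near \oo,
    n%:R / (n%:R + (b + r'%:R)) *
      (n%:R ^+ (i + r') * iter r' fdiff (fun m => (m%:R + b) ^- i : K^o) n
       - r'%:R * (n%:R ^+ (i.+1 + r'.-1) *
           iter r'.-1 fdiff (fun m => (m%:R + b) ^- i.+1 : K^o) n))
    = n%:R ^+ (i.+1 + r') *
        iter r' fdiff (fun m => (m%:R + b) ^- i.+1 : K^o) n.
  near=> n.
  have nb m : (n <= m)%N -> m%:R + b != 0.
    by move: m; near: n; exact: near_infty_neq0.
  have nbr : n%:R + (b + r'%:R) != 0.
    rewrite (addrC b) addrA -natrD.
    by apply: nb; rewrite leq_addr.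
  have := @iter_fdiff_mulX K b (fun m => (m%:R + b) ^- i.+1) r' n.
  rewrite (@iter_fdiff_eq K K^o _ (fun m => (m%:R + b) ^- i)); last first.
    by move=> m nm; rewrite exprS invfM mulrA divff ?nb// mul1r.
  move=> ->; case: (r') nbr => [|q] nbr /=; last first.
    rewrite !addSn !addnS !exprS; field.
    by move: nbr; rewrite -(natr1 q) (addrC q%:R).
  rewrite addr0 in nbr; rewrite !addn0 !addr0 !mul0r addr0 subr0 !exprS.
  by field; rewrite expf_neq0.
elim: r => [|r IHr]; apply: near_eq_cvg_to (rec _) _;
  rewrite -[X in _ --> X]mul1r; apply: cvgM; try exact: cvg_ratio_shift.
  rewrite big_ord0 mulr1 -[X in _ --> X]subr0; apply: cvgB.
    by have := IHi 0%N; rewrite big_ord0 mulr1.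
  by under eq_fun do rewrite mul0r; exact: cvg_cst.
(* Up to sign, (i+1)...(i+r) is a common factor, with cofactors i+r+1 on the left and i, r+1 on the
   right. *)
have -> : (-1) ^+ r.+1 * \prod_(s < r.+1) (i.+1 + s)%:R =
    (-1) ^+ r.+1 * \prod_(s < r.+1) (i + s)%:R
    - r.+1%:R * ((-1) ^+ r * \prod_(s < r) (i.+1 + s)%:R) :> K.
  rewrite big_ord_recr [in X in _ = X - _]big_ord_recl/= addn0.
  have -> : \prod_(j < r) (i + bump 0 j)%:R = \prod_(s < r) (i.+1 + s)%:R :> K.
    by apply: eq_bigr => j _; rewrite addnS.
  by rewrite exprS !natrD -[in RHS](natr1 r) -(natr1 i); ring.
by apply: cvgB => //; apply: cvgM => //; exact: cvg_cst.
Unshelve. all: by end_near. Qed.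

(** The expansion is cut at order [m + r], so that the remainder, which gains nothing from
    differencing, is still negligible. Terms before [m] vanish and those after [m] are of smaller
    order. *)
Lemma cvg_scale_iter_fdiff_expansion (K : numFieldType)
    (hK : n%:R^-1 @[n --> \oo] --> (0 : K)) (E : normedModType K) (b : K)
    (v F : nat -> E)
    (hF : asymptotic_expansion F (fun i n => (n%:R + b) ^- i *: v i))
    (m r : nat) :
  (0 < m)%N -> (forall i, (0 < i < m)%N -> v i = 0) ->
  n%:R ^+ (m + r) *: iter r fdiff F n
    @[n --> \oo] --> ((-1) ^+ r * \prod_(s < r) (m + s)%:R) *: v m.
Proof.
move=> m0 v0; set p := (m + r)%N.
have p0 : (0 < p)%N by rewrite addn_gt0 m0.
pose Rm n := F n - \sum_(1 <= i < p.+1) (n%:R + b) ^- i *: v i.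
have hR : n%:R ^+ p *: iter r fdiff Rm n @[n --> \oo] --> 0.
  by apply: cvg0_scale_iter_fdiff; apply/littleo_invnP; exact: hF.
rewrite -[X in _ --> X]addr0.
pose T i n := (n%:R ^+ p * iter r fdiff (fun m => (m%:R + b) ^- i : K^o) n)
  *: v i.
have -> : (fun n => n%:R ^+ p *: iter r fdiff F n) =
    (fun n => \sum_(1 <= i < p.+1) T i n + n%:R ^+ p *: iter r fdiff Rm n).
  apply/funext => n.
  have -> : iter r fdiff F n = iter r fdiff
      (fun n => \sum_(1 <= i < p.+1) (n%:R + b) ^- i *: v i + Rm n) n.
    by apply: iter_fdiff_eq => j _; rewrite /Rm addrC subrK.
  rewrite iter_fdiffD scalerDr iter_fdiff_sum scaler_sumr; congr (_ + _).
  by apply: eq_bigr => i _; rewrite iter_fdiffZr scalerA.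
apply: cvgD => //.
set L := _ *: v m.
have -> : L = \sum_(1 <= i < p.+1 | (1 <= i < p.+1)%N)
    (if i == m then L else 0).
  rewrite -big_nat -big_mkcond big_nat1_eq ifT//.
  by rewrite m0 ltnS leq_addr.
under eq_fun do rewrite big_nat.
apply: cvg_big => [|i /andP[i0 ip]]; first exact: add_continuous.
rewrite /T /L; case: eqP => [->|/eqP im].
  by apply: cvgZr_tmp; exact: cvg_scale_iter_fdiff_pow.
case: (ltngtP i m) im => // im _.
  by rewrite v0 ?i0//; under eq_fun do rewrite scaler0; exact: cvg_cst.
rewrite -(scale0r (v i)); apply: cvgZr_tmp.
(* Of the i - m surplus factors 1/n, one forces the limit 0 and the others stay bounded by 1. *)
have h1 : n%:R^-1 ^+ (i - m).-1 *: (n%:R^-1 * (n%:R ^+ (i + r)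
    * iter r fdiff (fun m => (m%:R + b) ^- i : K^o) n))
    @[n --> \oo] --> (0 : K^o).
  apply: (@cvgZ_bounded0 _ _ _ _ _ _ _ 1).
    near=> n; rewrite ger0_norm ?exprn_ge0 ?invr_ge0//.
    rewrite exprn_ile1 ?invr_ge0// invf_le1 ?ler1n ?ltr0n//.
      by near: n; exact: nbhs_infty_gt.
    by near: n; exact: nbhs_infty_gt.
  rewrite -(mul0r ((-1) ^+ r * \prod_(s < r) (i + s)%:R)).
  by apply: cvgM => //; exact: cvg_scale_iter_fdiff_pow.
apply: near_eq_cvg_to h1; near=> n.
have n0 : n%:R != 0 :> K.
  by rewrite pnatr_eq0 -lt0n; near: n; exact: nbhs_infty_gt.
rewrite /= /GRing.scale/= !mulrA -exprSr prednK ?subn_gt0//; congr (_ * _).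
have -> : (i + r = (i - m) + p)%N by rewrite /p; lia.
by rewrite exprD mulrA -exprMn mulVf// expr1n mul1r.
Unshelve. all: by end_near. Qed.

(** * Perturbed orthogonality relations and their solutions *)

Section PerturbedOrthogonality.
Context (K : numFieldType) (k m : nat) (w t : nat -> nat -> K).
Hypothesis w0 : \forall n \near \oo, w 0 n = 1.
Hypothesis t_cvg : forall q, t q n @[n --> \oo] --> ((m + q)`!%:R : K).
Hypothesis orth : \forall n \near \oo, forall j, (j < k)%N ->
  \sum_(r < k.+1) w r n * t (r + j)%N n = 0.

(** The monic polynomial (X+m+1)...(X+m+j), equal at r to (m+r+j)!/(m+r)!. *)
Let rising j : {poly K} := \prod_(s < j) ('X - (- (m + s.+1)%:R)%:P).

Let rising_fact j r : (m + r)`!%:R * (rising j).[r%:R] = (m + r + j)`!%:R :> K.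
Proof.
elim: j => [|j IH]; first by rewrite /rising big_ord0 hornerC mulr1 addn0.
rewrite /rising big_ord_recr hornerM mulrA IH hornerXsubC opprK.
rewrite [in RHS]addnS factS.
by rewrite natrM mulrC -natrD; congr (_%:R * _); rewrite /=; lia.
Qed.

(** With exact factorials in place of [t], the left sum would be 0, since the [rising j] with
    [j < k] span the polynomials of degree below [k]. The deviations of [t] go into [eta]. *)
Lemma perturbed_orth_poly (q : {poly K}) : (size q <= k)%N ->
  exists2 eta : nat -> nat -> K, (forall r, eta r n @[n --> \oo] --> (0 : K)) &
    \forall n \near \oo,
      \sum_(r < k.+1) w r n * ((m + r)`!%:R * q.[r%:R])
      = \sum_(r < k.+1) w r n * eta r n.
Proof.
(* Only the degree bound is generalised, to [d <= k]; the sums keep [k.+1] terms. Each step removes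
   a leading term by means of [rising d]. *)
move: {1 3}k (leqnn k) => d; elim: d q => [|d IH] q dk.
  rewrite leqn0 size_poly_eq0 => /eqP ->.
  exists (fun _ _ => 0) => [r|]; first exact: cvg_cst.
  by near=> n; apply: eq_bigr => r _; rewrite horner0 mulr0.
move=> qd.
have size_rising : size (rising d) = d.+1.
  by rewrite size_prod_XsubC -[index_enum _]enumT size_enum_ord.
have rising_lead : (rising d)`_d = 1.
  have := monic_prod_XsubC (index_enum 'I_d) xpredT
    (fun s : 'I_d => - (m + s.+1)%:R : K).
  by rewrite monicE lead_coefE -/(rising d) size_rising => /eqP.
have [||eta eta0 heta] := IH (q - q`_d *: rising d); first exact: ltnW.
  apply/leq_sizeP => j; rewrite leq_eqVlt coefB coefZ => /predU1P[<-|dj].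
    by rewrite rising_lead mulr1 subrr.
  rewrite [q`_j]nth_default ?[(rising d)`_j]nth_default ?size_rising//.
    by rewrite mulr0 subrr.
  exact: leq_trans dj.
exists (fun r n => eta r n + q`_d * ((m + r + d)`!%:R - t (r + d)%N n)) => [r|].
  rewrite -[X in _ --> X]addr0; apply: cvgD => //.
  rewrite -[X in _ --> X](mulr0 q`_d); apply: cvgM; first exact: cvg_cst.
  rewrite -(subrr (m + r + d)`!%:R). apply: cvgB; first exact: cvg_cst.
  by rewrite -addnA.
near=> n.
under [RHS]eq_bigr do rewrite mulrDr.
rewrite big_split/=; have <- : \sum_(r < k.+1) w r n *
    ((m + r)`!%:R * (q - q`_d *: rising d).[r%:R]) =
  \sum_(r < k.+1) w r n * eta r n by near: n.
have hd : \sum_(r < k.+1) w r n * t (r + d)%N n = 0.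
  by move: (d) dk; near: n; move: orth; apply: filterS => n h d' /h.
transitivity (\sum_(r < k.+1) w r n * ((m + r)`!%:R * q.[r%:R])
    - q`_d * \sum_(r < k.+1) w r n * t (r + d)%N n).
  by rewrite hd mulr0 subr0.
rewrite mulr_sumr -sumrB -big_split; apply: eq_bigr => r _ /=.
by rewrite hornerD hornerN hornerZ -(rising_fact d r); ring.
Unshelve. all: by end_near. Qed.

(** Lagrange polynomials express each coefficient as a constant plus a combination of all
    coefficients with null weights. Summing norms, the weights absorb at most half of the total. *)
Lemma perturbed_orth_bounded : exists C : K, \forall n \near \oo,
  forall r, (r <= k)%N -> `|w r n| <= C.
Proof.
have step (r0 : nat) : (r0 <= k)%N -> exists c : K,
    exists2 eta : nat -> nat -> K,
      (forall r, eta r n @[n --> \oo] --> (0 : K)) &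
    \forall n \near \oo,
      w r0 n = c + \sum_(r < k.+1) w r n * eta r n.
  case: r0 => [_|r0 r0k].
    exists 1, (fun _ _ => 0) => [r|]; first exact: cvg_cst.
    near=> n; rewrite big1 ?addr0 => [|r _]; last by rewrite mulr0.
    by near: n.
  (* Node 0 is left out because [w 0] is known; this leaves [k - 1] roots, hence size [k]. *)
  pose q : {poly K} :=
    \prod_(s <- [seq s <- iota 1 k | s != r0.+1]) ('X - s%:R%:P).
  have r0in : r0.+1 \in iota 1 k by rewrite mem_iota add1n ltnS.
  have qk : (size q <= k)%N.
    rewrite /q size_prod_XsubC size_filter.
    have := count_predC (pred1 r0.+1) (iota 1 k).
    rewrite size_iota (count_uniq_mem _ (iota_uniq _ _)) r0in add1n => kE.
    by rewrite -[X in (_ <= X)%N]kE.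
  have qr0 : q.[r0.+1%:R] != 0.
    rewrite /q horner_prod prodf_seq_neq0; apply/allP => s.
    by rewrite mem_filter hornerXsubC subr_eq0 eqr_nat eq_sym => /andP[].
  have qr r : (0 < r <= k)%N -> r != r0.+1 -> q.[r%:R] = 0.
    move=> rk rr0; rewrite /q horner_prod; apply/eqP.
    rewrite prodf_seq_eq0; apply/hasP; exists r.
      by rewrite mem_filter rr0 mem_iota add1n ltnS.
    by rewrite /= hornerXsubC subrr eqxx.
  have [eta eta0 heta] := perturbed_orth_poly qk.
  pose kappa : K := (m + r0.+1)`!%:R * q.[r0.+1%:R].
  have kappa0 : kappa != 0.
    by rewrite /kappa mulf_neq0 ?pnatr_eq0 -?lt0n ?fact_gt0.
  exists (- (kappa^-1 * (m`!%:R * q.[0]))), (fun r n => kappa^-1 * eta r n).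
    move=> r; rewrite -(mulr0 kappa^-1); apply: cvgM => //; exact: cvg_cst.
  near=> n.
  have w0n : w 0 n = 1 by near: n.
  have : \sum_(r < k.+1) w r n * ((m + r)`!%:R * q.[r%:R])
      = \sum_(r < k.+1) w r n * eta r n by near: n.
  rewrite big_ord_recl w0n mul1r addn0 (bigD1 (Ordinal r0k))//= big1 ?addr0.
    under [in X in _ -> X]eq_bigr do rewrite mulrCA.
    rewrite -mulr_sumr => <-.
    rewrite -/kappa mulrDr addKr mulrCA.
    by rewrite mulVf ?mulr1.
  move=> i ir0; by rewrite qr ?mulr0// /bump leq0n ?add1n ?eqSS ?ltnS ?ltn_ord.
(* Chosen so that [k.+1] errors [del * M n] add up to [M n / 2]. *)
pose del : K := (k.+1%:R *+ 2)^-1.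
have del0 : 0 < del by rewrite invr_gt0 pmulrn_lgt0// ltr0n.
pose M n := \sum_(r < k.+1) `|w r n|.
have partial N : (N <= k.+1)%N -> exists C : K, \forall n \near \oo,
    \sum_(r < N) `|w r n| <= C + N%:R * (del * M n).
  elim: N => [_|N IH Nk].
    by exists 0; near=> n; rewrite big_ord0 mul0r addr0.
  have [C hC] := IH (ltnW Nk).
  have [c [eta eta0 hc]] := step N Nk.
  exists (C + `|c|); near=> n.
  rewrite big_ord_recr/= -natr1 mulrDl mul1r addrACA; apply: lerD.
    by near: n.
  have -> : w N n = c + \sum_(r < k.+1) w r n * eta r n by near: n.
  rewrite (le_trans (ler_normD _ _))// lerD2l (le_trans (ler_norm_sum _ _ _))//.
  rewrite /M mulr_sumr; apply: ler_sum => r _; rewrite normrM mulrC.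
  apply: ler_wpM2r => //; move: r; near: n.
  apply: filter_forall => r; exact: cvgr0_norm_le.
have [C hC] := partial k.+1 (leqnn _).
exists (C *+ 2); near=> n => r rk.
have : M n <= C + k.+1%:R * (del * M n) by near: n.
have -> : k.+1%:R * (del * M n) = M n / 2.
  by rewrite /del -mulr_natr; field; rewrite ?pnatr_eq0.
rewrite -lerBlDr => hM.
apply: (@le_trans _ _ (M n)).
  by rewrite /M (bigD1 (Ordinal (rk : (r < k.+1)%N)))//= lerDl sumr_ge0.
have -> : M n = (M n - M n / 2) *+ 2 by rewrite -mulr_natr; field.
exact: ler_wMn2r.
Unshelve. all: by end_near. Qed.

Lemma cvg_perturbed_orth (q : {poly K}) : (size q <= k)%N ->
  \sum_(r < k.+1) w r n * ((m + r)`!%:R * q.[r%:R]) @[n --> \oo] --> (0 : K).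
Proof.
move=> /perturbed_orth_poly[eta eta0 heta].
have [C hC] := perturbed_orth_bounded.
apply: (@near_eq_cvg_to _ _ _ _ (fun n => \sum_(r < k.+1) w r n * eta r n)).
  by near=> n; symmetry; near: n.
rewrite -[X in _ --> X](@big1 K 0 +%R _ (index_enum 'I_k.+1) xpredT
  (fun=> 0))//.
apply: cvg_big => [|r _]; first exact: add_continuous.
apply: (@cvgZ_bounded0 _ K^o _ _ _ _ _ C) => //.
by near=> n; have /(_ r (ltn_ord r)) :
  forall r, (r <= k)%N -> `|w r n| <= C by near: n.
Unshelve. all: by end_near. Qed.

End PerturbedOrthogonality.

(** As r! = (1+r)!/(r+1), the sum would tend to 0 if 1/(r+1) were a polynomial of degree below k.
    Its interpolant at r = 1, ..., k fails only at r = 0, with value 1 - 1/(k+1) instead of 1; since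
    [w 0 n] is 1, this defect is the limit. *)
Lemma cvg_perturbed_orth_fact (K : numFieldType) (k : nat)
    (w t : nat -> nat -> K) :
  (\forall n \near \oo, w 0 n = 1) ->
  (forall q, t q n @[n --> \oo] --> ((1 + q)`!%:R : K)) ->
  (\forall n \near \oo, forall j, (j < k)%N ->
     \sum_(r < k.+1) w r n * t (r + j)%N n = 0) ->
  \sum_(r < k.+1) w r n * r`!%:R @[n --> \oo] --> (k.+1%:R^-1 : K).
Proof.
move=> w0 t_cvg orth.
pose Q : {poly K} := \prod_(s < k) ('X - (s.+1%:R)%:P).
(* Here Q(-1) = (-1)^k (k+1)! and Q(0) = (-1)^k k!. *)
have QN1 : Q.[-1] = k.+1%:R * Q.[0].
  rewrite /Q !horner_prod; elim: (k) => [|d IH].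
    by rewrite !big_ord0 mul1r.
  by rewrite !big_ord_recr/= IH !hornerXsubC; ring.
have Q0 : Q.[0] != 0.
  rewrite /Q horner_prod; apply/prodf_neq0 => s _.
  by rewrite hornerXsubC sub0r oppr_eq0 pnatr_eq0.
have sizeQ : size Q = k.+1.
  by rewrite size_prod_XsubC -[index_enum _]enumT size_enum_ord.
have k0 : k.+1%:R != 0 :> K by rewrite pnatr_eq0.
(* The quotient q of P by X + 1 takes the value 1/(r+1) at r = 1, ..., k. *)
pose P := 1 - Q.[-1]^-1 *: Q.
have /factor_theorem[q Pq] : root P (-1).
  by rewrite rootE /P !hornerE mulVf ?subrr// QN1 mulf_neq0.
have qk : (size q <= k)%N.
  have [->|q0] := eqVneq q 0; first by rewrite size_poly0.
  have := size_Mmonic q0 (monicXsubC (-1)).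
  rewrite -Pq size_XsubC addn2/= -ltnS => <-.
  rewrite /P (leq_trans (size_polyD _ _))// geq_max size_poly1/= size_polyN.
  by rewrite -sizeQ size_scale_leq.
have qr (r : nat) : r.+1%:R * q.[r%:R] = P.[r%:R].
  by rewrite Pq hornerM hornerXsubC opprK natr1 mulrC.
have Pr (r : nat) : (r < k)%N -> P.[r.+1%:R] = 1.
  move=> rk; rewrite /P !hornerE.
  suff -> : Q.[r.+1%:R] = 0 by rewrite mulr0 subr0.
  by rewrite /Q horner_prod (bigD1 (Ordinal rk))//= hornerXsubC subrr mul0r.
have P0 : P.[0] = 1 - k.+1%:R^-1.
  by rewrite /P !hornerE QN1 invfM -mulrA mulVf ?mulr1.
apply: (@near_eq_cvg_to _ _ _ _ (fun n => k.+1%:R^-1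
    + \sum_(r < k.+1) w r n * ((1 + r)`!%:R * q.[r%:R]))); last first.
  rewrite -[X in _ --> X]addr0; apply: cvgD; first exact: cvg_cst.
  exact: cvg_perturbed_orth w0 t_cvg orth _ qk.
near=> n.
have w0n : w 0 n = 1 by near: n.
rewrite big_ord_recl [in RHS]big_ord_recl /= w0n !mul1r.
have -> : q.[0] = P.[0] by rewrite -(qr 0) mul1r.
rewrite P0 addrA addrCA subrr addr0; congr (_ + _); apply: eq_bigr => r _.
by rewrite /bump leq0n !add1n factS natrM mulrAC qr Pr// mul1r.
Unshelve. all: by end_near. Qed.

(** * The Shanks system in Newton form *)

Lemma iter_fdiff_shift (K : numFieldType) (E : normedModType K) (f : nat -> E)
    (i r n : nat) :
  iter r fdiff (fun m => f (m + i)%N) n = iter r fdiff f (n + i)%N.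
Proof. by elim: r n => [//|r IH] n /=; rewrite /fdiff !IH. Qed.

Lemma iter_fdiff_vanish (K : numFieldType) (E : normedModType K)
    (f : nat -> E) (r n : nat) :
  (forall i, (i <= r)%N -> f (n + i)%N = 0) -> iter r fdiff f n = 0.
Proof.
elim: r n => [|r IH] n f0 /=; first by rewrite -[n]addn0 f0.
rewrite /fdiff !IH ?subrr// => i ir; first by apply: f0; exact: leqW.
by rewrite addSnnS; exact: f0.
Qed.

Section ShanksNewton.
Context (K : numFieldType) (E : normedModType K) (k : nat).
Implicit Types (c : 'rV[K]_k.+1) (f : nat -> E).

(** Coefficients in powers of z - 1 of the polynomial with coefficients [c] in powers of z; z stands
    for the shift and z - 1 for the difference. *)
Definition newton_coef c (r : nat) : K := \sum_(i < k.+1) c 0 i * 'C(i, r)%:R.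

Lemma newton_coef0 c : newton_coef c 0 = \sum_(i < k.+1) c 0 i.
Proof. by apply: eq_bigr => i _; rewrite bin0 mulr1. Qed.

Lemma sum_newton_coef c f n :
  \sum_(i < k.+1) c 0 i *: f (n + i)%N
  = \sum_(r < k.+1) newton_coef c r *: iter r fdiff f n.
Proof.
under eq_bigr => i _.
  rewrite (newton_forward f n (ltn_ord i)) scaler_sumr.
  under eq_bigr do rewrite scalerA.
  over.
by rewrite exchange_big; apply: eq_bigr => r _; rewrite -scaler_suml.
Qed.

End ShanksNewton.

(** The sum is the [j]-th difference at n of the sequence p -> sum_l c_l y(S_(p+l+1) - S_(p+l)),
    which the system makes vanish at n, ..., n+k-1. *)
Lemma is_shanks_coefs_newton (K : numFieldType) (E : normedModType K)
    (y : {linear E -> K^o}) (S : nat -> E) (Slim : E) (k n : nat)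
    (c : 'rV[K]_k.+1) (j : nat) :
  is_shanks_coefs y S n c -> (j < k)%N ->
  \sum_(r < k.+1) newton_coef c r
    * iter (r + j).+1 fdiff (fun m => y (S m - Slim)) n = 0.
Proof.
move=> [_ hc] jk; pose s m : K^o := y (S m - Slim).
have sE m : y (fdiff S m) = fdiff s m.
  by rewrite /fdiff /s -linearB; congr (y _); rewrite opprB addrA subrK.
transitivity (\sum_(r < k.+1) newton_coef c r *:
    iter r fdiff (iter j fdiff (fdiff s)) n).
  by apply: eq_bigr => r _; rewrite -iterD -iterSr.
rewrite -sum_newton_coef.
under eq_bigr do rewrite -iter_fdiff_shift -iter_fdiffZ.
rewrite -iter_fdiff_sum; apply: iter_fdiff_vanish => i ij.
rewrite -[RHS](hc i (leq_ltn_trans ij jk)).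
by apply: eq_bigr => l _; rewrite sE.
Qed.

Lemma asymptotic_expansion_linear (K : numFieldType) (E : normedModType K)
    (y : {linear E -> K^o}) (hy : continuous y) (F : nat -> E)
    (g : nat -> nat -> K) (v : nat -> E) :
  asymptotic_expansion F (fun i n => g i n *: v i) ->
  asymptotic_expansion (fun n => y (F n)) (fun i n => g i n *: y (v i)).
Proof.
move=> hF p p0; apply/littleo_invnP.
have /littleo_invnP hp := hF p p0.
have := cvg_comp _ _ hp (hy 0); rewrite linear0.
apply: near_eq_cvg_to; near=> n.
rewrite /= linearZ linearB linear_sum; congr (_ *: (_ - _)).
by apply: eq_bigr => i _; rewrite linearZ.
Unshelve. all: by end_near. Qed.

(** The coefficients sum to 1, so [Slim] moves inside the combination. *)
Lemma topological_shanks1_newton (K : numFieldType) (E : normedModType K)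
    (y : E -> K) (S : nat -> E) (Slim : E) (k n : nat) :
  is_shanks_coefs y S n (shanks_coefs y S k n) ->
  topological_shanks1 y S k n - Slim
  = \sum_(r < k.+1) newton_coef (shanks_coefs y S k n) r
      *: iter r fdiff (fun m => S m - Slim) n.
Proof.
move=> [c1 _]; rewrite -sum_newton_coef -[X in _ - X]scale1r -c1 scaler_suml.
by rewrite -sumrB; apply: eq_bigr => i _; rewrite scalerBr.
Qed.

Lemma prod_natr_fact (R : pzSemiRingType) (m q : nat) :
  m`!%:R * \prod_(s < q) (m.+1 + s)%:R = (m + q)`!%:R :> R.
Proof.
elim: q => [|q IH]; first by rewrite big_ord0 mulr1 addn0.
by rewrite big_ord_recr/= mulrA IH -natrM mulnC addSn addnS.
Qed.

(** * Leading term of the transforms *)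

Theorem theorem8 (K : numFieldType) (hK : real_or_complex K)
  (E : normedModType K) (y : {linear E -> K^o}) (hy : continuous y)
  (S : nat -> E) (Slim : E) (a : nat -> K) (b : K) (u : nat -> E)
  (hS : asymptotic_expansion (fun n => S n - Slim)
          (fun i n => (a i * (n%:R + b) ^- i) *: u i))
  (* The functional does not annihilate the leading term, nor the whole
     expansion. *)
  (hlead : a 1%N *: u 1%N != 0 -> y (a 1%N *: u 1%N) != 0)
  (hnz : exists2 m : nat, (0 < m)%N & y (a m *: u m) != 0)
  (k : nat)
  (hsol : \forall n \near \oo,
            exists! c : 'rV[K]_k.+1, is_shanks_coefs y S n c) :
  (fun n => topological_shanks1 y S k n - Slim
              - (a 1%N / (k.+1%:R * (n%:R + b))) *: u 1%N)
    =o_\oo (fun n => n%:R^-1 : K^o).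
Proof.
have hK0 := real_or_complex_cvg_invn hK.
pose F n := S n - Slim.
pose v i := a i *: u i.
have hF : asymptotic_expansion F (fun i n => (n%:R + b) ^- i *: v i).
  suff -> : (fun i n => (n%:R + b) ^- i *: v i) =
      (fun i n => (a i * (n%:R + b) ^- i) *: u i) by [].
  by apply/funext => i; apply/funext => n; rewrite scalerA mulrC.
have hyF := asymptotic_expansion_linear hy hF.
(* The least index not annihilated by [y] is written [m.+1], so that m! completes the rising
   products to factorials. *)
have [m ym mmin] : exists2 m, y (v m.+1) != 0 &
    forall i, (0 < i < m.+1)%N -> y (v i) = 0.
  have exm : exists m, (0 < m)%N && (y (v m) != 0).
    by case: hnz => m m0 ym; exists m; rewrite m0.
  case: (ex_minnP exm) => -[//|m] /andP[_ ym] mmin; exists m => // i.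
  move=> /andP[i0 im].
  apply/eqP/negPn/negP => yi; have := mmin i.
  by rewrite i0 yi leqNgt im => /(_ isT).
pose alpha : K := y (v m.+1).
pose c n := shanks_coefs y S k n.
pose w r n : K := (-1) ^+ r * n%:R ^- r * newton_coef (c n) r.
(* The order is [q.+1] because the system starts from first differences; the prefactor normalises
   the limit to (m+1+q)!. *)
pose t q n : K := (-1) ^+ q.+1 * alpha^-1 * m`!%:R
  * (n%:R ^+ (m.+1 + q.+1) * iter q.+1 fdiff (fun j => y (F j)) n).
(* Once a solution exists, [shanks_coefs] is one, rather than the default 0. *)
have hc : \forall n \near \oo, is_shanks_coefs y S n (c n).
  apply: filterS hsol => n [c0 [hc0 _]].
  by apply: (@xgetPex _ 0 [set c | is_shanks_coefs y S n c]); exists c0.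
have w0 : \forall n \near \oo, w 0 n = 1.
  apply: filterS hc => n [c1 _].
  by rewrite /w newton_coef0 c1 !expr0 invr1 !mulr1.
have t_cvg q : t q n @[n --> \oo] --> ((m.+1 + q)`!%:R : K).
  rewrite addSnnS -prod_natr_fact.
  have -> : m`!%:R * \prod_(s < q.+1) (m.+1 + s)%:R =
      (-1) ^+ q.+1 * alpha^-1 * m`!%:R
      * (((-1) ^+ q.+1 * \prod_(s < q.+1) (m.+1 + s)%:R) * alpha) :> K.
    transitivity (((-1) ^+ q.+1 * (-1) ^+ q.+1) * (alpha^-1 * alpha)
      * (m`!%:R * \prod_(s < q.+1) (m.+1 + s)%:R)); last by ring.
    by rewrite -expr2 sqrr_sign mulVf// !mul1r.
  apply: cvgM; first exact: cvg_cst.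
  exact: (cvg_scale_iter_fdiff_expansion hK0 hyF).
have orth : \forall n \near \oo, forall j, (j < k)%N ->
    \sum_(r < k.+1) w r n * t (r + j)%N n = 0.
  near=> n => j jk.
  have n0 : n%:R != 0 :> K.
    by rewrite pnatr_eq0 -lt0n; near: n; exact: nbhs_infty_gt.
  have hcn : is_shanks_coefs y S n (c n) by near: n.
  (* [e] gathers the factors independent of [r]; the remaining sign and power of n cancel those in
     [w]. *)
  pose e : K := (-1) ^+ j.+1 * alpha^-1 * m`!%:R * n%:R ^+ (m.+1 + j.+1).
  transitivity (e * \sum_(r < k.+1) newton_coef (c n) r
      * iter (r + j).+1 fdiff (fun i => y (S i - Slim)) n); last first.
    by rewrite (is_shanks_coefs_newton Slim hcn jk) mulr0.
  rewrite mulr_sumr /e.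
  apply: eq_bigr => r _; rewrite /w /t.
  set D := iter _ _ _ _.
  have -> : (m.+1 + (r + j).+1 = m.+1 + j.+1 + r)%N by rewrite /=; lia.
  have -> : (-1) ^+ (r + j).+1 = (-1) ^+ r * (-1) ^+ j.+1 :> K.
    by rewrite -exprD addnS.
  rewrite (exprD _ (m.+1 + j.+1)); set x := n%:R ^+ (m.+1 + j.+1).
  set x' := n%:R ^+ r.
  have x'0 : x' != 0 by rewrite expf_neq0.
  transitivity (((-1) ^+ r * (-1) ^+ r) * (x'^-1 * x') *
   ((-1) ^+ j.+1 * alpha^-1 * m`!%:R * x 
     * (newton_coef (c n) r * D))); first by ring.
  by rewrite -expr2 sqrr_sign mulVf// !mul1r.
pose phi r n := ((-1) ^+ r * n%:R ^+ (1 + r)) *: iter r fdiff F n.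
have phi_cvg r : phi r n @[n --> \oo] --> r`!%:R *: v 1%N.
  have -> : r`!%:R *: v 1%N = (-1) ^+ r *:
      (((-1) ^+ r * \prod_(s < r) (1 + s)%:R) *: v 1%N).
    rewrite scalerA mulrA -expr2 sqrr_sign mul1r.
    by rewrite -[r in r`!]add0n -prod_natr_fact mul1r.
  under eq_fun do rewrite /phi -scalerA.
  apply: cvgZl_tmp.
  by apply: (cvg_scale_iter_fdiff_expansion hK0 hF) => // -[|i].
have [C hC] := perturbed_orth_bounded w0 t_cvg orth.
have sum_w : (\sum_(r < k.+1) w r n * r`!%:R) *: v 1%N
    @[n --> \oo] --> k.+1%:R^-1 *: v 1%N.
  (* If [v 1%N] is zero, both sides vanish. Otherwise [hlead] forces [m = 0], the case in which the
     weights are (1+q)!. *)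
  have [->|v1] := eqVneq (v 1%N) 0.
    by rewrite scaler0; under eq_fun do rewrite scaler0; exact: cvg_cst.
  have m0 : m = 0%N.
    apply/eqP/negPn/negP; rewrite -lt0n => m0.
    by have := hlead v1; rewrite mmin ?eqxx.
  apply: cvgZr_tmp; apply: (cvg_perturbed_orth_fact w0 _ orth) => q.
  by have := t_cvg q; rewrite m0.
have main : n%:R *: (topological_shanks1 y S k n - Slim)
    @[n --> \oo] --> k.+1%:R^-1 *: v 1%N.
  (* Each [phi r n] is split into its limit and a null error, which the bounded [w r n] keeps
     null. *)
  apply: (@near_eq_cvg_to _ _ _ _ (fun n =>
      (\sum_(r < k.+1) w r n * r`!%:R) *: v 1%N
      + \sum_(r < k.+1) w r n *: (phi r n - r`!%:R *: v 1%N))).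
    near=> n.
    have n0 : n%:R != 0 :> K.
      by rewrite pnatr_eq0 -lt0n; near: n; exact: nbhs_infty_gt.
    have hcn : is_shanks_coefs y S n (c n) by near: n.
    rewrite (topological_shanks1_newton Slim hcn) scaler_sumr scaler_suml.
    rewrite -big_split; apply: eq_bigr => r _ /=.
    rewrite scalerBr (scalerA (w r n) _ (v 1%N)) addrC subrK /phi !scalerA.
    congr (_ *: _).
    rewrite /w exprD expr1.
    transitivity (((-1) ^+ r * (-1) ^+ r) * (n%:R ^- r * n%:R ^+ r)
      * (n%:R * newton_coef (c n) r)); first by ring.
    by rewrite -expr2 sqrr_sign mulVf ?expf_neq0// !mul1r.
  rewrite -[X in _ --> X]addr0; apply: cvgD => //.
  rewrite -[X in _ --> X](@big1 E 0 +%R _ (index_enum 'I_k.+1) xpredT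
    (fun=> 0))//.
  apply: cvg_big => [|r _]; first exact: add_continuous.
  apply: (@cvgZ_bounded0 _ _ _ _ _ _ _ C).
    by near=> n; have /(_ r (ltn_ord r)) :
      forall r, (r <= k)%N -> `|w r n| <= C by near: n.
  by apply/subr_cvg0.
apply/(littleo_invnP 1).
rewrite -(subrr (k.+1%:R^-1 *: v 1%N)).
apply: (@near_eq_cvg_to _ _ _ _ (fun n =>
    n%:R *: (topological_shanks1 y S k n - Slim)
    - (k.+1%:R^-1 * (n%:R / (n%:R + b))) *: v 1%N)).
  near=> n; rewrite expr1 [RHS]scalerBr; congr (_ - _); rewrite !scalerA.
  by congr (_ *: _); rewrite invfM; ring.
apply: cvgB => //; apply: cvgZr_tmp; rewrite -[X in _ --> X]mulr1.
by apply: cvgM; [exact: cvg_cst | exact: cvg_ratio_shift].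
Unshelve. all: by end_near. Qed.
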